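(* Let $\ell\geqslant 3$ be an integer and let $p=(\ell-2)r+e$ and $q=(\ell-2)r+f$, where $r\geqslant 0$ is an integer, $1\leqslant e\leqslant \ell-2$ and $1\leqslant f\leqslant \ell-2$. Then $$m(p,q,\ell)=r\ell(\ell-2)+ef.$$
   Context: All graphs are simple. An ordered bipartite graph $(G;A,B)$ is a bipartite graph $G$ whose vertex set is partitioned into independent sets $A$ and $B$, each equipped with a linear order. Two vertices $u<v$ of the same part are consecutive if no vertex $w$ of that part satisfies $u<w<v$. Identifying two consecutive vertices $u,v$ replaces them by a single vertex $w$ (in their place in the order) whose neighbourhood is the union of the neighbourhoods of $u$ and $v$. Two ordered bipartite graphs are isomorphic if there is a graph isomorphism between them that maps parts to parts (possibly exchanging the two parts) and preserves both linear orders. An ordered bipartite graph $H$ is an interval minor of $G$ if a graph isomorphic to $H$ can be obtained from $G$ by repeatedly deleting edges and identifying consecutive vertices; otherwise $G$ is $H$-interval minor free. $ex(p,q,H)$ denotes the maximum number of edges of an ordered bipartite graph with parts of sizes $p$ and $q$ that is $H$-interval minor free, and $m(p,q,\ell)$ denotes $ex(p,q,K_{2,\ell})$, where $K_{2,\ell}$ is the complete bipartite graph with parts of sizes $2$ and $\ell$. *)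

(* Defs.v *)
From mathcomp Require Import all_boot.
From mathcomp Require Import boolp.
From Stdlib Require Import Relation_Operators.

Set Implicit Arguments.
Unset Strict Implicit.
Unset Printing Implicit Defensive.

(* A finite linear order is determined by its size, so the parts A and B are
   taken to be 'I_p and 'I_q with their natural order.  The pair (a, b) stands
   for the edge joining a in A to b in B. *)
Record obgraph := OBGraph {
  sizeA : nat;
  sizeB : nat;
  edges : {set 'I_sizeA * 'I_sizeB}
}.

Definition consecutive n (u v : 'I_n) : bool :=
  (u < v) && [forall w : 'I_n, ~~ (u < w < v)].

(* [unbump u] maps both u and u.+1 to u, and is injective and increasing
   otherwise, so the vertex in place u of the result is adjacent to all the
   neighbours of u and of u.+1.  Meaningful only if u is not the last vertex;
   this is ensured by [consecutive u v] below, which forces v = u.+1. *)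
Definition identifyA n q (u : 'I_n.+1) (E : {set 'I_n.+1 * 'I_q}) :
    {set 'I_n * 'I_q} :=
  [set x : 'I_n * 'I_q |
    [exists a : 'I_n.+1, (unbump u a == x.1 :> nat) && ((a, x.2) \in E)]].

Definition identifyB p n (u : 'I_n.+1) (E : {set 'I_p * 'I_n.+1}) :
    {set 'I_p * 'I_n} :=
  [set x : 'I_p * 'I_n |
    [exists b : 'I_n.+1, (unbump u b == x.2 :> nat) && ((x.1, b) \in E)]].

Inductive minor_step : obgraph -> obgraph -> Prop :=
| DeleteEdge p q (E : {set 'I_p * 'I_q}) x :
    x \in E -> minor_step (OBGraph E) (OBGraph (E :\ x))
| IdentifyA n q (E : {set 'I_n.+1 * 'I_q}) (u v : 'I_n.+1) :
    consecutive u v -> minor_step (OBGraph E) (OBGraph (identifyA u E))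
| IdentifyB p n (E : {set 'I_p * 'I_n.+1}) (u v : 'I_n.+1) :
    consecutive u v -> minor_step (OBGraph E) (OBGraph (identifyB u E)).

Definition swap_parts (G : obgraph) : obgraph :=
  OBGraph [set x : 'I_(sizeB G) * 'I_(sizeA G) | (x.2, x.1) \in edges G].

Definition part_iso (G H : obgraph) : Prop :=
  exists (f : 'I_(sizeA G) -> 'I_(sizeA H)) (g : 'I_(sizeB G) -> 'I_(sizeB H)),
    [/\ bijective f, bijective g,
        {homo f : x y / (x < y)%N}, {homo g : x y / (x < y)%N}
      & forall a b, ((f a, g b) \in edges H) = ((a, b) \in edges G)].

Definition ob_iso (G H : obgraph) : Prop :=
  part_iso G H \/ part_iso (swap_parts G) H.

Definition interval_minor (H G : obgraph) : Prop :=
  exists2 G' : obgraph, clos_refl_trans obgraph minor_step G G' & ob_iso G' H.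

Definition interval_minor_free (H G : obgraph) : Prop := ~ interval_minor H G.

(* The maximum is 0 if no graph with parts of sizes p and q is H-interval
   minor free. *)
Definition ex_interval (p q : nat) (H : obgraph) : nat :=
  \max_(E : {set 'I_p * 'I_q} | `[< interval_minor_free H (OBGraph E) >]) #|E|.

Definition complete_ob (s t : nat) : obgraph := OBGraph [set: 'I_s * 'I_t].

Definition m_interval (p q l : nat) : nat := ex_interval p q (complete_ob 2 l).

(* Main.v *)
(* Put d = l - 2 and read G as a 0/1 matrix.  G contains K_{2,l} iff its rows
   and columns can be cut into 2 and l intervals (or l and 2) with a one in
   each block.

   Lower bound: r blocks of ones of size (d+1) x (d+1) followed by one of size
   e x f, placed along the diagonal, consecutive blocks sharing a corner.

   Upper bound: let X_i be the set of ones of row i having a one below them in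
   their column, so that |E| <= q + sum_{i < p} |X_i|.  Cutting the rows below
   row i gives |X_i| <= d + 1.  A cut of the columns separates two elements of
   X_i for at most d rows i, since these rows and the rows below the last of
   them form intervals meeting both sides of the cut.  Hence the spans of the
   X_i form an interval graph of clique number at most d, and can be coloured
   with d colours.  In a colour class of n rows the spans are disjoint, so
   sum (|X_i| - 1) <= min (d n, q - 1); this is concave in n, so the total over
   the d classes is largest when the p - 1 rows are distributed evenly:
   e - 1 classes of r + 1 rows and d - e + 1 classes of r rows. *)
Require Import Defs.
From mathcomp Require Import all_boot.
From mathcomp Require Import boolp zify.
From Stdlib Require Import Relation_Operators.

Set Implicit Arguments.
Unset Strict Implicit.
Unset Printing Implicit Defensive.

(** * Interval minors as monotone labellings of rows and columns *)

Definition adj p q (E : {set 'I_p * 'I_q}) (i j : nat) : Prop :=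
  exists2 x, x \in E & x.1 = i :> nat /\ x.2 = j :> nat.

(* f sends a row to its interval among s, g a column to its interval among t. *)
Definition blocks s t (R : nat -> nat -> Prop) : Prop :=
  exists f g : nat -> nat,
    [/\ {homo f : x y / x <= y}, {homo g : x y / x <= y},
        (forall i, f i < s), (forall j, g j < t)
      & forall a b, a < s -> b < t -> exists i j, [/\ R i j, f i = a & g j = b]].

Lemma blocks_sym s t (R : nat -> nat -> Prop) :
  blocks s t R -> blocks t s (fun i j => R j i).
Proof.
move=> [f [g [mf mg bf bg H]]]; exists g, f; split=> // a b la lb.
by have [i [j [Rij fi gj]]] := H b a lb la; exists j, i.
Qed.

(** Labels are pulled back along [h] and [k]: [unbump] for an identification, the identity for a
    deletion. *)
Lemma blocks_map s t (R R' : nat -> nat -> Prop) (h k : nat -> nat) :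
    {homo h : x y / x <= y} -> {homo k : x y / x <= y} ->
    (forall i' j', R' i' j' -> exists i j, [/\ R i j, h i = i' & k j = j']) ->
  blocks s t R' -> blocks s t R.
Proof.
move=> mh mk HR [f [g [mf mg bf bg H]]]; exists (f \o h), (g \o k); split=> //=.
- by move=> x y /mh/mf.
- by move=> x y /mk/mg.
move=> a b la lb; have [i' [j' [/HR [i [j [Rij <- <-]]] <- <-]]] := H a b la lb.
by exists i, j.
Qed.

Lemma unbump_mono u : {homo unbump u : x y / x <= y}.
Proof. by move=> x y; rewrite /unbump; lia. Qed.

Lemma bump_mono u : {homo bump u : x y / x <= y}.
Proof. by move=> x y; rewrite /bump; lia. Qed.

Lemma minor_step_blocks s t G G' : minor_step G G' ->
  blocks s t (adj (edges G')) -> blocks s t (adj (edges G)).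
Proof.
case=> [p q E x xE|n q E u v uv|p n E u v uv] /=.
- apply: (@blocks_map _ _ _ _ id id) => // i j [y]; rewrite inE => /andP[_ yE] [<- <-].
  by exists y.1, y.2; split=> //; exists y.
- apply: (@blocks_map _ _ _ _ (unbump u) id) => //; first exact: unbump_mono.
  move=> i j [y]; rewrite inE => /existsP[a /andP[/eqP ua aE]] [<- <-].
  by exists a, y.2; split=> //; exists (a, y.2).
- apply: (@blocks_map _ _ _ _ id (unbump u)) => //; first exact: unbump_mono.
  move=> i j [y]; rewrite inE => /existsP[a /andP[/eqP ua aE]] [<- <-].
  by exists y.1, a; split=> //; exists (y.1, a).
Qed.

Lemma minor_blocks s t G G' : clos_refl_trans obgraph minor_step G G' ->
  blocks s t (adj (edges G')) -> blocks s t (adj (edges G)).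
Proof. by elim=> [? ? /minor_step_blocks| |? ? ? _ H1 _ H2 /H2/H1]; auto. Qed.

Lemma homo_ord_leq m n (f : 'I_m -> 'I_n) :
  {homo f : x y / (x < y)%N} -> {homo f : x y / (x <= y)%N}.
Proof.
move=> mf x y; rewrite leq_eqVlt => /orP[/eqP /val_inj -> //|/mf]; exact: ltnW.
Qed.

Lemma part_iso_blocks s t G : 0 < s -> 0 < t ->
  part_iso G (complete_ob s t) -> blocks s t (adj (edges G)).
Proof.
case: s => // s _; case: t => // t _ [f [g [bf bg mf mg H]]].
have [f' fK f'K] := bf; have [g' gK g'K] := bg.
have ext m n (h : 'I_m -> 'I_n.+1) : 0 < m -> {homo h : x y / (x < y)%N} ->
    exists k : nat -> nat, [/\ {homo k : x y / x <= y}, (forall i, k i < n.+1)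
                             & forall i, k (val i) = h i].
  (* Past the last index the value is frozen, which keeps the extension monotone and in range. *)
  case: m h => // m h _ /homo_ord_leq mh; exists (fun i => h (inord (minn i m))).
  split=> // [x y xy|i]; first by apply: mh; rewrite !inordK; lia.
  by congr (val (h _)); apply: val_inj; rewrite /= inordK; have := ltn_ord i; lia.
have [|k [mk bk kf]] := ext _ _ f _ mf; first by case: (f' ord0) => i; lia.
have [|h [mh bh hg]] := ext _ _ g _ mg; first by case: (g' ord0) => i; lia.
exists k, h; split=> // a b la lb.
exists (f' (Ordinal la)), (g' (Ordinal lb)).
rewrite kf hg f'K g'K; split=> //.
by exists (f' (Ordinal la), g' (Ordinal lb)) => //; rewrite -H f'K g'K inE.
Qed.

Lemma interval_minor_blocks s t G : 0 < s -> 0 < t ->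
    interval_minor (complete_ob s t) G ->
  blocks s t (adj (edges G)) \/ blocks t s (adj (edges G)).
Proof.
move=> s0 t0 [G' GG' [|] /(part_iso_blocks s0 t0) H]; [left|right];
  apply: (minor_blocks GG') => //.
have {H} := blocks_sym H.
apply: (@blocks_map _ _ _ _ id id) => // i j [[x1 x2]]; rewrite inE /= => xE [<- <-].
by exists x2, x1; split=> //; exists (x2, x1).
Qed.

(** Below [p], values never repeat, so [i <= f i]; none is skipped, so [f i <= i]. *)
Lemma homo_surj_id p s (f : nat -> nat) :
    {homo f : x y / x <= y} -> (forall i, f i < s) ->
    (forall a, a < s -> exists2 i, i < p & f i = a) ->
    (forall u, u.+1 < p -> f u <> f u.+1) ->
  p = s /\ forall i, i < p -> f i = i.
Proof.
move=> mf bf sf nf.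
have lo i : i < p -> i <= f i.
  elim: i => // i IH ip; have := IH (ltnW ip); have := nf i ip.
  by have := mf i i.+1 (leqnSn i); lia.
have s0 : 0 < s by have := bf 0; lia.
have ps : p <= s.
  case: p lo {sf nf} => // p lo; have := lo p (ltnSn p); have := bf p; lia.
have hi i : i < p -> f i <= i.
  elim: i => [|i IH] ip.
    have [k _ fk] := sf 0 s0; have := mf 0 k (leq0n k); lia.
  have [k _ fk] := sf i.+1 (leq_trans ip ps).
  have [ki|ik] := leqP k i; first by have := mf k i ki; have := IH (ltnW ip); lia.
  by have := mf i.+1 k ik; lia.
split=> [|i ip]; last by have := lo i ip; have := hi i ip; lia.
have [|k kp fk] := sf s.-1; first lia.
have := hi k kp; lia.
Qed.

(** [bump u.+1 \o unbump u] moves only [u.+1], to [u]. *)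
Lemma bump_unbump_collapse (f : nat -> nat) u a :
  f u = f u.+1 -> f (bump u.+1 (unbump u a)) = f a.
Proof.
move=> fu; have [->|ne] := eqVneq a u.+1; last by congr f; rewrite /bump /unbump; lia.
by rewrite -fu; congr f; rewrite /bump /unbump; lia.
Qed.

Lemma consecutive_succ n (u v : 'I_n) : v = u.+1 :> nat -> consecutive u v.
Proof. by move=> vu; apply/andP; split; [lia|apply/forallP => w; lia]. Qed.

(** Induction on [p + q]: neighbours with equal labels are identified; once there are none, the
    labels are the identity and [E] is complete. *)
Lemma blocks_minor s t p q (E : {set 'I_p * 'I_q}) : blocks s t (adj E) ->
  exists2 G, clos_refl_trans obgraph minor_step (OBGraph E) G
           & part_iso G (complete_ob s t).
Proof.
have [n] := ubnP (p + q); elim: n p q E => // n IH p q E pqn.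
move=> [f [g [mf mg bf bg H]]].
have [[u [up fu]]|nf] := pselect (exists u, u.+1 < p /\ f u = f u.+1).
  case: p E H up pqn => // p E H up pqn.
  have uv : consecutive (Ordinal (ltnW up)) (Ordinal up) by exact: consecutive_succ.
  have [||G EG iG] := IH p q (identifyA (Ordinal (ltnW up)) E); first by lia.
    exists (f \o bump u.+1), g; split=> //= [x y xy|a b la lb].
      by apply/mf/bump_mono.
    have [_ [_ [[[x y] xE [/= <- <-]] fx gy]]] := H a b la lb.
    exists (unbump u x), y; rewrite bump_unbump_collapse //; split=> //.
    have xu : unbump u x < p by have := ltn_ord x; rewrite /unbump; lia.
    exists (Ordinal xu, y) => //; rewrite inE; apply/existsP; exists x.
    by rewrite eqxx.
  by exists G => //; apply: rt_trans EG; apply: rt_step; apply: IdentifyA uv.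
have [[u [uq gu]]|ng] := pselect (exists u, u.+1 < q /\ g u = g u.+1).
  case: q E H uq pqn => // q E H uq pqn.
  have uv : consecutive (Ordinal (ltnW uq)) (Ordinal uq) by exact: consecutive_succ.
  have [||G EG iG] := IH p q (identifyB (Ordinal (ltnW uq)) E); first by lia.
    exists f, (g \o bump u.+1); split=> //= [x y xy|a b la lb].
      by apply/mg/bump_mono.
    have [_ [_ [[[x y] xE [/= <- <-]] fx gy]]] := H a b la lb.
    exists x, (unbump u y); rewrite bump_unbump_collapse //; split=> //.
    have yu : unbump u y < q by have := ltn_ord y; rewrite /unbump; lia.
    exists (x, Ordinal yu) => //; rewrite inE; apply/existsP; exists y.
    by rewrite eqxx.
  by exists G => //; apply: rt_trans EG; apply: rt_step; apply: IdentifyB uv.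
have s0 : 0 < s by apply: leq_trans (bf 0).
have t0 : 0 < t by apply: leq_trans (bg 0).
have [||ps fid] := homo_surj_id mf bf (p := p).
- move=> a la; have [_ [_ [[x _ [<- _]] fx _]]] := H a 0 la t0.
  by exists x.1.
- by move=> u up fu; apply: nf; exists u.
have [||qt gid] := homo_surj_id mg bg (p := q).
- move=> b lb; have [_ [_ [[x _ [_ <-]] _ gx]]] := H 0 b s0 lb.
  by exists x.2.
- by move=> u uq gu; apply: ng; exists u.
subst p q; exists (OBGraph E); first exact: rt_refl.
exists id, id; split=> //; try by exists id.
move=> a b; rewrite inE /=.
have [_ [_ [[[x y] xE [/= <- <-]]]]] := H a b (ltn_ord a) (ltn_ord b).
rewrite fid // gid // => xa yb.
by have [<- <-] : x = a /\ y = b by split; apply: val_inj.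
Qed.

Lemma blocks_interval_minor s t p q (E : {set 'I_p * 'I_q}) :
    blocks s t (adj E) \/ blocks t s (adj E) ->
  interval_minor (complete_ob s t) (OBGraph E).
Proof.
move=> [|] /blocks_minor [G EG iG]; exists G => //; first by left.
right; have [f [g [bf bg mf mg H]]] := iG.
by exists g, f; split=> // a b; rewrite /= !inE; have := H b a; rewrite inE /= => <-.
Qed.

(** * Lower bound: the chain of squares *)

(* (i, j) lies in a square [k d, (k+1) d]^2; the best k is minn i j %/ d. *)
Definition chain_edge d i j := maxn i j <= (minn i j %/ d).+1 * d.

Lemma chain_edgeC d i j : chain_edge d i j = chain_edge d j i.
Proof. by rewrite /chain_edge maxnC minnC. Qed.

Lemma chain_free d : 0 < d -> ~ blocks 2 d.+2 (chain_edge d).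
Proof.
move=> d0 [f [g [mf mg bf bg H]]].
have [i1 [_ [_ fi1 _]]] := H 1 0 isT isT.
(* [t] starts the second interval of rows, so [t.-1] ends the first. *)
have [|t ft tmin] := @ex_minnP (fun i => f i == 1); first by exists i1; rewrite fi1.
have t0 : 0 < t.
  have [i0 [_ [_ fi0 _]]] := H 0 0 isT isT.
  by rewrite lt0n; apply: contraL ft => /eqP ->; have := mf 0 i0 isT; lia.
(* The rows above t only meet columns <= (k+1) d, the others only columns
   >= k d, so each of the d + 2 intervals of columns meets [k d, (k+1) d]. *)
pose k := t.-1 %/ d.
have kt : k * d <= t.-1 by exact: leq_divM.
have tk : t.-1 < k.+1 * d by rewrite -ltn_divLR.
suff sub : {subset iota 0 d.+2 <= map g (iota (k * d) d.+1)}.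
  by have := uniq_leq_size (iota_uniq _ _) sub; rewrite size_map !size_iota ltnn.
move=> b; rewrite mem_iota => /andP[_ bd].
have [i [j [ij fi gj]]] := H 0 b isT bd; have [i' [j' [ij' fi' gj']]] := H 1 b isT bd.
have it : i <= t.-1.
  have [ti|] := leqP t i; last by lia.
  by have := mf t i ti; rewrite fi (eqP ft).
have jk : j <= k.+1 * d.
  apply: leq_trans (leq_maxr i j) _; apply: leq_trans ij _; rewrite leq_mul2r ltnS.
  by rewrite leq_div2r ?orbT //; lia.
have jk' : k * d <= j'.
  apply: leq_trans (leq_trans (leq_divM _ d) (geq_minr i' j')).
  rewrite leq_mul2r; apply/orP; right; rewrite -ltnS -(ltn_pmul2r d0).
  apply: leq_trans (leq_trans (leq_maxl i' j') ij').
  by have := tmin i'; rewrite fi' eqxx => /(_ isT); lia.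
apply/mapP; have [kj|jlt] := leqP (k * d) j.
  by exists j => //; rewrite mem_iota kj; lia.
have [kj|jgt] := leqP j' (k.+1 * d); first by exists j' => //; rewrite mem_iota jk'; lia.
(* Columns [j] and [j'] lie on either side of the range with the same label [b], hence [k * d]
   between them has it too. *)
exists (k * d); first by rewrite mem_iota leqnn; lia.
by have := mg j (k * d) (ltnW jlt); have := mg (k * d) j' jk'; lia.
Qed.

Lemma leq_sum_nat_const n c (F : nat -> nat) :
  (forall i, i < n -> c <= F i) -> n * c <= \sum_(0 <= i < n) F i.
Proof.
move=> cF; rewrite big_mkord -{1}(card_ord n) -sum_nat_const.
by apply: leq_sum => i _; apply: cF.
Qed.

Lemma sum_nat_shift d n (F : nat -> nat) :
  \sum_(d <= i < d + n) F i = \sum_(0 <= i < n) F (i + d).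
Proof. by rewrite -{1}[d]add0n big_addn addKn. Qed.

Lemma chain_edge_shift d i j : 0 < d -> chain_edge d (i + d) (j + d) = chain_edge d i j.
Proof.
move=> d0; rewrite /chain_edge -addn_minl -addn_maxl divnDr // divnn d0 addn1.
by rewrite [in LHS]mulSn [d + _]addnC leq_add2r.
Qed.

Lemma chain_edge_near d i j : i <= d -> j <= d -> chain_edge d i j.
Proof.
move=> id_ jd; rewrite /chain_edge mulSn; apply: leq_trans (leq_addr _ _).
by rewrite geq_max id_.
Qed.

(** Induction on [r]: the first [d] rows have [d * d.+1] ones in the first [d.+1] columns, row [d]
    has [d] ones in the first [d] columns, and from row and column [d] on lies the smaller chain,
    shifted. *)
Lemma chain_count d r e f : 0 < d -> 0 < e <= d -> 0 < f <= d ->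
  r * (d * d.+2) + e * f <=
  \sum_(0 <= i < d * r + e) \sum_(0 <= j < d * r + f) chain_edge d i j.
Proof.
move=> d0 he hf; elim: r => [|r IH].
  rewrite muln0 !add0n; apply: leq_sum_nat_const => i ie.
  rewrite -[f in f <= _]muln1; apply: leq_sum_nat_const => j jf.
  by rewrite chain_edge_near //; lia.
set m := d * r + e in IH *; set n := d * r + f in IH *.
have -> : d * r.+1 + e = d + m by rewrite mulnS addnA.
have -> : d * r.+1 + f = d + n by rewrite mulnS addnA.
have m0 : 0 < m by lia.
have n0 : 0 < n by lia.
rewrite (@big_cat_nat _ _ _ d) ?leq_addr //=.
have top : d * d.+1 <= \sum_(0 <= i < d) \sum_(0 <= j < d + n) chain_edge d i j.
  apply: leq_sum_nat_const => i id_; rewrite (@big_cat_nat _ _ _ d.+1) //=; last by lia.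
  apply: leq_trans (leq_addr _ _); rewrite -[X in X <= _]muln1.
  by apply: leq_sum_nat_const => j jd; rewrite chain_edge_near //; lia.
have bot : d + \sum_(0 <= i < m) \sum_(0 <= j < n) chain_edge d i j <=
    \sum_(d <= i < d + m) \sum_(0 <= j < d + n) chain_edge d i j.
  rewrite sum_nat_shift [leqRHS](eq_bigr (fun i => \sum_(0 <= j < d) chain_edge d (i + d) j
     + \sum_(0 <= j < n) chain_edge d i j)); last first.
    move=> i _; rewrite [LHS](@big_cat_nat _ _ _ d) ?leq_addr //=. congr (_ + _).
    rewrite sum_nat_shift; apply: eq_bigr => j _.
    by rewrite chain_edge_shift.
  rewrite big_split leq_add2r /= big_ltn //; apply: leq_trans (leq_addr _ _).
  rewrite add0n -[X in X <= _]muln1; apply: leq_sum_nat_const => j jd.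
  by rewrite chain_edge_near //; lia.
apply: leq_trans (leq_add top bot).
apply: (@leq_trans (d * d.+1 + (d + (r * (d * d.+2) + e * f)))).
  by rewrite mulSn -addnA [d * d.+2]mulnS; lia.
by rewrite !leq_add2l.
Qed.

(** * Colouring and packing of intervals *)

Lemma interval_coloring (I : finType) d (a b : I -> nat) : 0 < d ->
    (forall c, #|[set i | a i <= c < b i]| <= d) ->
  exists k : I -> 'I_d, forall c i i',
    a i <= c < b i -> a i' <= c < b i' -> k i = k i' -> i = i'.
Proof.
move=> d0 cov.
suff H n (S : {set I}) : #|S| = n -> exists k : I -> 'I_d, {in S &, forall i i' c,
    a i <= c < b i -> a i' <= c < b i' -> k i = k i' -> i = i'}.
  have [k Hk] := H _ [set: I] erefl.
  by exists k => c i i'; apply: Hk; rewrite inE.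
(* Colour greedily by increasing left endpoint: the earlier intervals meeting
   the last one all contain its left endpoint. *)
elim: n S => [|n IH] S cS.
  by exists (fun=> Ordinal d0) => i; rewrite (cards0_eq cS) inE.
have [j0 j0S] : exists j0, j0 \in S by apply/set0Pn; rewrite -card_gt0 cS.
have [m mSb mmax] := @arg_maxnP _ j0 [in S] a j0S.
have mS : m \in S := mSb.
have [|k Hk] := IH (S :\ m); first by have := cardsD1 m S; rewrite cS mS; lia.
pose J := [set i in S :\ m | a m < b m & a i <= a m < b i].
have Jd : #|J| < d.
  (* An empty interval meets nothing; otherwise [m] itself covers [a m] and is not in [J], which
     makes the bound strict. *)
  have [ab|ba] := ltnP (a m) (b m); last first.
    rewrite (_ : J = set0) ?cards0 //; apply/setP => i; rewrite !inE.
    by rewrite ltnNge ba andbF.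
  apply: leq_trans (cov (a m)); apply: proper_card; apply/properP; split.
    by apply/subsetP => i; rewrite !inE => /and3P[_ _].
  by exists m; rewrite !inE ?eqxx // leqnn.
have [c0 c0J] : exists c0, c0 \notin k @: J.
  apply/existsP; rewrite -negb_forall; apply: contraTN Jd => /forallP all.
  rewrite -leqNgt -{1}(card_ord d); apply: leq_trans (leq_imset_card k J).
  by apply: subset_leq_card; apply/subsetP => c _; have := all c.
have colJ i c : i \in S -> i != m -> a i <= c < b i -> a m <= c < b m -> k i != c0.
  move=> iS im ci cm; apply: contraNneq c0J => <-; apply: imset_f.
  by rewrite !inE im iS; have := mmax i iS; lia.
exists (fun i => if i == m then c0 else k i) => i i' iS i'S c ci ci'.
case: eqVneq => [im|im]; case: eqVneq => [im'|im'].
- by rewrite im im'.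
- by move=> ck; have := colJ i' c i'S im' ci'; rewrite -im ck eqxx => /(_ ci).
- by move=> ck; have := colJ i c iS im ci; rewrite -im' ck eqxx => /(_ ci').
- by move=> kk; apply: (Hk i i' _ _ c); rewrite ?inE ?im ?im'.
Qed.

(** Double counting: each of the [Q] points lies in at most one interval. *)
Lemma leq_sum_disjoint_intervals (I : finType) (A : pred I) (a b : I -> nat) Q :
    (forall i, b i <= Q) ->
    (forall c, {in A &, forall i i', a i <= c < b i -> a i' <= c < b i' -> i = i'}) ->
  \sum_(i | A i) (b i - a i) <= Q.
Proof.
move=> bQ dis.
have len i : b i - a i = \sum_(c < Q) (a i <= c < b i).
  rewrite -{1}(minn_idPl (bQ i)); elim: Q {bQ} => [|Q IH]; first by rewrite big_ord0; lia.
  by rewrite big_ord_recr /= -IH; lia.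
rewrite (eq_bigr _ (fun i _ => len i)) exchange_big /=.
rewrite -[leqRHS]card_ord -sum1_card; apply: leq_sum => c _.
rewrite -big_mkcondr sum1_card; apply/card_le1_eqP => i i'.
by move=> /andP[Ai ci] /andP[Ai' ci']; apply: (dis c).
Qed.

(** The pair is (min, max), and a point [c] of the half-open span is the cut between [c] and [c.+1].
    The empty set gets an empty span. *)
Lemma set_span q (X : {set 'I_q}) :
  exists ab : nat * nat, [/\ ab.2 <= q.-1, #|X| <= (ab.2 - ab.1).+1
    & forall c, ab.1 <= c < ab.2 -> exists j j', [/\ j \in X, j' \in X & j <= c < j']].
Proof.
have [->|[j0 j0X]] := set_0Vmem X.
  by exists (0, 0); split=> //=; rewrite ?cards0 // => c; lia.
have [m mX mmin] := @arg_minnP _ j0 [in X] val j0X.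
have [M MX Mmax] := @arg_maxnP _ j0 [in X] val j0X.
exists (val m, val M); split=> /= [||c cmM]; last by exists m, M.
  by have := ltn_ord M; lia.
have inj : {in X &, injective (fun j : 'I_q => inord (j - m) : 'I_(M - m).+1)}.
  move=> j j' jX j'X /(congr1 val) jj'; apply: val_inj; rewrite /= in jj' *.
  have := mmin _ jX; have := mmin _ j'X; have := Mmax _ jX; have := Mmax _ j'X.
  by move=> /= *; rewrite !inordK in jj'; lia.
rewrite -(card_in_imset inj) -[leqRHS]card_ord; exact: max_card.
Qed.

(** * Cutting an axis by a set of indices *)

(** As a label, the rank cuts the axis just after each element of [S]; indices past all of [S] form
    one more interval. *)
Definition rank n (S : {set 'I_n}) (x : nat) := #|[set y in S | y < x]|.

Lemma rank_mono n (S : {set 'I_n}) : {homo rank S : x y / x <= y}.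
Proof.
move=> x y xy; apply/subset_leq_card/subsetP => z; rewrite !inE => /andP[-> zx].
exact: leq_trans zx xy.
Qed.

Lemma rank_full n (S : {set 'I_n}) x : (forall y, y \in S -> y < x) -> rank S x = #|S|.
Proof. by move=> Sx; apply: eq_card => y; rewrite inE andb_idr //; apply: Sx. Qed.

Lemma rank_surj n (S : {set 'I_n}) k : k < #|S| -> exists2 x, x \in S & rank S x = k.
Proof.
(* The rank jumps at the least such [x], so [x] belongs to [S]. *)
move=> kS; have [|x kx xmin] := @ex_minnP (fun x => k < rank S x.+1).
  by exists n; rewrite rank_full // => y _; apply: ltnW; rewrite ltnS.
have xk : rank S x <= k.
  case: x {kx} xmin => [|x] xmin; last by rewrite leqNgt; apply/negP => /xmin; lia.
  by rewrite (_ : rank S 0 = 0) //; apply: eq_card0 => y; rewrite !inE andbF.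
have [y yS yx] : exists2 y, y \in S & y = x :> nat.
  apply: contrapT => no; move: kx; rewrite ltnNge; apply/negP/negPn.
  apply: leq_trans xk; apply/subset_leq_card/subsetP => y; rewrite !inE.
  move=> /andP[yS yx]; rewrite yS /= ltn_neqAle -ltnS yx andbT.
  by apply/eqP => yx'; apply: no; exists y.
exists y => //; apply/eqP; rewrite eqn_leq yx xk -ltnS; apply: leq_trans kx _.
apply: (@leq_trans (#|[set y]| + rank S x)); last by rewrite cards1.
apply: leq_trans _ (leq_of_leqif (leq_card_setU _ _)).
apply/subset_leq_card/subsetP => z; rewrite !inE => /andP[-> zx] /=.
by rewrite -(inj_eq val_inj) /= yx; lia.
Qed.

(** The cap at [t] merges the intervals from label [t] on; the other axis is cut after [c]. *)
Lemma blocks_of_rank n (S : {set 'I_n}) c t (R : nat -> nat -> Prop) :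
    (forall k, k <= t ->
       (exists u i, [/\ R u i, i <= c & minn (rank S u) t = k]) /\
       (exists u i, [/\ R u i, c < i & minn (rank S u) t = k])) ->
  blocks t.+1 2 R.
Proof.
move=> H; exists (fun u => minn (rank S u) t), (fun i => nat_of_bool (c < i)).
split=> [x y /(rank_mono S)|x y|u|i|k b kt]; try lia.
have [[u [i [ui ic uk]]] [v [j [vj cj vk]]]] := H k kt.
case: b => [|[|//]] _; first by exists u, i; split=> //; lia.
by exists v, j; split=> //; lia.
Qed.

(** * Upper bound *)

(** The set X_i of the opening sketch. *)
Definition not_lowest p q (E : {set 'I_p * 'I_q}) (i : 'I_p) : {set 'I_q} :=
  [set j | ((i, j) \in E) && [exists x : 'I_p, (i < x) && ((x, j) \in E)]].

Lemma not_lowestP p q (E : {set 'I_p * 'I_q}) i j : j \in not_lowest E i ->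
  (i, j) \in E /\ exists2 x : 'I_p, i < x & (x, j) \in E.
Proof.
by rewrite inE => /andP[ij /existsP[x /andP[ix xj]]]; split=> //; exists x.
Qed.

(** The ones left out are the lowest of their columns, at most one per column. *)
Lemma leq_card_not_lowest p q (E : {set 'I_p * 'I_q}) :
  #|E| <= q + \sum_(i < p) #|not_lowest E i|.
Proof.
pose B := [set x | x.2 \in not_lowest E x.1].
rewrite -(cardsID B E) addnC; apply: leq_add.
  have inj : {in E :\: B &, injective (fun x : 'I_p * 'I_q => x.2)}.
    move=> [i j] [i' j']; rewrite !inE /= => /andP[nij ij] /andP[nij' ij'] jj'.
    subst j'; congr (_, _); apply: val_inj; apply/eqP.
    rewrite ij ij' /= in nij nij'; move: nij nij'; rewrite !negb_exists.
    move=> /forallP/(_ i') + /forallP/(_ i); rewrite ij ij' !andbT /=; lia.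
  by rewrite -(card_in_imset inj) -[leqRHS]card_ord; exact: max_card.
apply: (@leq_trans #|B|); first exact: subset_leq_card (subsetIr _ _).
rewrite -sum1_card (eq_bigr (fun i => \sum_(j in not_lowest E i) 1)); last first.
  by move=> i _; rewrite sum1_card.
by rewrite pair_big_dep /= [leqRHS](eq_bigl [in B]) // => x; rewrite [RHS]inE.
Qed.

(** Cut the columns after the elements of X_i and the rows after row [i]: each of these columns has
    a one in row [i] and one below. *)
Lemma card_not_lowest p q (E : {set 'I_p * 'I_q}) t i :
  ~ blocks 2 t.+1 (adj E) -> #|not_lowest E i| <= t.
Proof.
move=> nb; rewrite leqNgt; apply/negP => tX; apply: nb.
apply: (@blocks_sym t.+1 2 (fun i j => adj E j i)).
apply: (@blocks_of_rank _ (not_lowest E i) i) => k kt.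
have [|j /not_lowestP[ij [x ix xj]] jk] := @rank_surj _ (not_lowest E i) k; first lia.
by split; [exists j, i|exists j, x]; split; rewrite ?jk ?(minn_idPl kt) //;
  [exists (i, j)|exists (x, j)].
Qed.

(* The rows of S, together with the union of the rows below the last of them,
   are the #|S| + 1 intervals of rows. *)
Lemma card_crossing p q (E : {set 'I_p * 'I_q}) t c (S : {set 'I_p}) : 0 < t ->
    ~ blocks t.+1 2 (adj E) ->
    {in S, forall i, exists j j',
       [/\ j \in not_lowest E i, j' \in not_lowest E i & j <= c < j']} ->
  #|S| < t.
Proof.
move=> t0 nb cS; rewrite ltnNge; apply/negP => tS; apply: nb.
apply: (@blocks_of_rank _ S c) => k; rewrite leq_eqVlt => /orP[/eqP ->|kt].
  (* Rows below the last row [m] of [S] get label [t]; they have ones in columns [j] and [j'], on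
     both sides of the cut. *)
  have [i0 i0S] : exists i, i \in S by apply/set0Pn; rewrite -card_gt0; lia.
  have [m mSb mmax] := @arg_maxnP _ i0 [in S] val i0S; have mS : m \in S := mSb.
  have [j [j' [/not_lowestP[_ [x mx xj]] /not_lowestP[_ [x' mx' xj']] jcj']]] := cS m mS.
  have full y : m < y -> minn (rank S y) t = t.
    move=> my; rewrite rank_full ?(minn_idPr tS) // => z zS.
    exact: leq_ltn_trans (mmax z zS) my.
  by split; [exists x, j|exists x', j']; split; rewrite ?full //; try lia;
    [exists (x, j)|exists (x', j')].
have [|i iS ik] := @rank_surj _ S k; first exact: leq_trans kt tS.
have [j [j' [/not_lowestP[ij _] /not_lowestP[ij' _] jcj']]] := cS i iS.
by split; [exists i, j|exists i, j']; split; rewrite ?ik ?(minn_idPl (ltnW kt)) //;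
  try lia; [exists (i, j)|exists (i, j')].
Qed.

(** Here [p], [q], [e], [f] are one less than in the theorem: the last row has nothing below it, and
    a span has length at most [q]. *)
Lemma leq_card_free p q d r e f (E : {set 'I_p.+1 * 'I_q.+1}) :
    0 < d -> f <= d -> p = d * r + e -> q = d * r + f ->
    ~ blocks 2 d.+2 (adj E) -> ~ blocks d.+2 2 (adj E) ->
  #|E| <= r * (d * d.+2) + e.+1 * f.+1.
Proof.
move=> d0 fd hp hq nb2 nb1; pose X (i : 'I_p) := not_lowest E (widen_ord (leqnSn p) i).
have EX : #|E| <= q.+1 + \sum_(i < p) #|X i|.
  apply: leq_trans (leq_card_not_lowest E) _; rewrite big_ord_recr /=.
  rewrite [#|not_lowest E ord_max|]eq_card0 ?addn0 // => j.
  apply/negbTE/negP => /not_lowestP[_ [x]] /=; have := ltn_ord x; lia.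
have [ab Hab] := fin_all_exists (fun i => set_span (X i)).
pose a i := (ab i).1; pose b i := (ab i).2.
have cov c : #|[set i | a i <= c < b i]| <= d.
  have inj : injective (widen_ord (leqnSn p)).
    by move=> i i' /(congr1 val) /= /val_inj.
  rewrite -(card_imset _ inj) -ltnS.
  apply: (card_crossing (c := c) (E := E)) => // _ /imsetP[i + ->].
  by rewrite inE; have [_ _] := Hab i; apply.
have [k Hk] := interval_coloring d0 cov.
(* [y i] bounds [#|X i| - 1] both through [card_not_lowest] and through the span. *)
pose y i := minn d (b i - a i).
have Xy i : #|X i| <= 1 + y i.
  have [_ Xi _] := Hab i; have := card_not_lowest (widen_ord (leqnSn p) i) nb2.
  by rewrite -/(X i) /y /a /b; lia.
pose n s := #|[set i | k i == s]|.
(* min (d n) q lies below the line through its values at n = r and n = r + 1. *)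
have class s : \sum_(i | k i == s) y i + r * f <= d * r + n s * f.
  have ydn : \sum_(i | k i == s) y i <= n s * d.
    rewrite /n -sum_nat_const [leqRHS](eq_bigl (fun i => k i == s)).
      by apply: leq_sum => i _; exact: geq_minl.
    by move=> i; rewrite inE.
  have yq : \sum_(i | k i == s) y i <= q.
    apply: (@leq_trans (\sum_(i | k i == s) (b i - a i))).
      by apply: leq_sum => i _; exact: geq_minr.
    apply: leq_sum_disjoint_intervals => [i|c i i' /eqP ki /eqP ki' ci ci'].
      by have [] := Hab i.
    by apply: (Hk c); rewrite // ki ki'.
  (* Up to [r] rows the bound [n s * d] suffices, since [f <= d]; beyond, the bound [q] does. *)
  have [nr|rn] := leqP (n s) r.
    have := leq_mul (leqnn (r - n s)) fd; rewrite !mulnBl.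
    have := leq_mul nr (leqnn f); have := leq_mul nr (leqnn d); lia.
  have := leq_mul rn (leqnn f); rewrite mulSn; lia.
have np : \sum_s n s = p.
  rewrite -[RHS]card_ord -sum1_card (partition_big k xpredT) //=.
  by apply: eq_bigr => s _; rewrite sum1_card /n; apply: eq_card => i; rewrite inE.
have Y : \sum_i y i + d * (r * f) <= d * (d * r) + p * f.
  rewrite (partition_big k xpredT) //= -[X in _ <= _ + X * f]np big_distrl /=.
  rewrite -[X in _ + X * (r * f)]card_ord -[X in _ <= X * _ + _]card_ord -!sum_nat_const.
  by rewrite -!big_split /=; apply: leq_sum => s _; exact: class.
have XY : \sum_(i < p) #|X i| <= p + \sum_i y i.
  rewrite -[X in _ <= X + _]card_ord -sum1_card -big_split /=.
  by apply: leq_sum => i _; exact: Xy.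
(* The bounds add up to [q.+1 + p + d * (d * r) + e * f], since [p * f - d * (r * f) = e * f]. *)
move: EX XY Y; move: #|E| (\sum_(i < p) #|X i|) (\sum_i y i) => N S T.
rewrite hp hq; nia.
Qed.

(** * The two bounds together *)

Theorem theorem2p5 (l p q r e f : nat)
  (hl : 3 <= l)
  (he : 1 <= e <= l - 2) (hf : 1 <= f <= l - 2)
  (hp : p = (l - 2) * r + e) (hq : q = (l - 2) * r + f) :
  m_interval p q l = r * l * (l - 2) + e * f.
Proof.
have [d ld] : exists d, l = d.+2 by exists (l - 2); lia.
subst l; rewrite !subSS subn0 in he hf hp hq *; have d0 : 0 < d by lia.
rewrite -mulnA [d.+2 * d]mulnC; apply/eqP; rewrite eqn_leq; apply/andP; split.
  apply/bigmax_leqP => E /asboolP free.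
  case: e f he hf hp hq => [|e] // [|f] // he hf hp hq.
  rewrite addnS in hp; rewrite addnS in hq; subst p q.
  apply: leq_card_free => //.
  - by case/andP: hf => _ /ltnW.
  - by move=> nb; apply: free; apply: blocks_interval_minor; left.
  - by move=> nb; apply: free; apply: blocks_interval_minor; right.
pose E : {set 'I_p * 'I_q} := [set x : 'I_p * 'I_q | chain_edge d x.1 x.2].
have EE i j : adj E i j -> chain_edge d i j by case=> x; rewrite inE => ? [<- <-].
have free : interval_minor_free (complete_ob 2 d.+2) (OBGraph E).
  move=> /(@interval_minor_blocks 2 d.+2 _ isT isT) [|] H; apply: (chain_free d0).
    by apply: (@blocks_map _ _ _ _ id id _ _ _ H) => // i j /EE; exists i, j.
  have {}H := blocks_sym H.
  apply: (@blocks_map _ _ _ _ id id _ _ _ H) => // i j /EE ij.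
  by exists i, j; rewrite chain_edgeC.
apply: (@leq_trans #|E|); last by apply: leq_bigmax_cond; apply/asboolP.
apply: leq_trans (chain_count r d0 he hf) _; rewrite -hp -hq big_mkord.
rewrite (eq_bigr (fun i : 'I_p => \sum_(j < q) chain_edge d i j)); last first.
  by move=> i _; rewrite big_mkord.
rewrite pair_big /= -big_mkcond sum1_card.
by apply/subset_leq_card/subsetP => x; rewrite !inE.
Qed.
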